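(* Let $k,\rho,c,\ell,\gamma,D_\infty,h_0>0$ and $0<\varepsilon<1$ be real constants and let $\alpha=\frac{k}{\rho c}$. Suppose that $$h_0>h_0^*:=\frac{1}{D_\infty}\sqrt{\frac{\gamma(1-\varepsilon)\rho\ell k}{2}}.$$ Then the solution $(T,s,r)$ of Problem $(P_1)$ (stated in the context) is given by $$T(x,t)=-\frac{\frac{h_0D_\infty\sqrt{\pi\alpha}}{k}\operatorname{erf}(\xi)}{1+\frac{h_0\sqrt{\pi\alpha}}{k}\operatorname{erf}(\xi)}\left[1-\frac{\operatorname{erf}\left(\frac{x}{2\sqrt{\alpha t}}\right)}{\operatorname{erf}(\xi)}\right],\quad 0<x<s(t),\ t>0,$$ $$s(t)=2\xi\sqrt{\alpha t},\qquad r(t)=2\mu\sqrt{\alpha t},\qquad t>0,$$ with $$\mu=\xi+\frac{\gamma k}{2D_\infty h_0\sqrt{\alpha}}\,e^{\xi^2}\left[1+\frac{h_0\sqrt{\pi\alpha}}{k}\operatorname{erf}(\xi)\right],$$ where the coefficient $\xi>0$ is the unique solution of the equation $$\frac{D_\infty c}{\ell\sqrt{\pi}}F(x)=G(x),\quad x>0,$$ with $$F(x)=\frac{e^{-x^2}}{\frac{k}{h_0\sqrt{\pi\alpha}}+\operatorname{erf}(x)},\qquad G(x)=x+\frac{\gamma(1-\varepsilon)\sqrt{\pi}}{2D_\infty}\,\frac{1}{F(x)},\qquad x>0.$$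
   Context: $\operatorname{erf}(x)=\frac{2}{\sqrt{\pi}}\int_0^x e^{-u^2}\,du$. Problem $(P_1)$ (one-phase solidification with a mushy zone and a convective boundary condition): find free boundaries $x=s(t)$, $x=r(t)$ with $s(t)<r(t)$ for $t>0$, and a temperature $T=T(x,t)$, such that - $T_t-\alpha T_{xx}=0$ for $0<x<s(t)$, $t>0$; - $T(s(t),t)=0$ for $t>0$; - $kT_x(s(t),t)=\rho\ell[\varepsilon\dot s(t)+(1-\varepsilon)\dot r(t)]$ for $t>0$; - $T_x(s(t),t)\,(r(t)-s(t))=\gamma$ for $t>0$; - $s(0)=r(0)=0$; - $kT_x(0,t)=\frac{h_0}{\sqrt t}\,(T(0,t)+D_\infty)$ for $t>0$. Values of $T$ and $T_x$ at $x=0$ and $x=s(t)$ are those of the smooth extension of $T$ up to the boundary. ''The solution is given by'' means: the equation for $\xi$ has exactly one solution $\xi>0$, and the functions $T,s,r$ defined by the formulas satisfy all the conditions of the problem. *)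

(* Defs.v *)
From Stdlib Require Import Reals.
From Coquelicot Require Import Coquelicot.
Open Scope R_scope.

Definition erf (x : R) : R :=
  2 / sqrt PI * RInt (fun u => exp (- u ^ 2)) 0 x.

(* [U] is C^infinity on an open neighbourhood of the region
   {(x, t) | t > 0, 0 <= x <= s(t)} and extends the restriction of [T] to
   its interior {(x, t) | t > 0, 0 < x < s(t)}.
   [ex_diff_n U n x t] says that all partial derivatives of [U] of order at
   most [n] exist and are (jointly) continuous at (x, t). *)
Definition smooth_extension (s : R -> R) (T U : R -> R -> R) : Prop :=
  (exists Omega : R * R -> Prop,
     open Omega /\
     (forall x t, 0 < t -> 0 <= x <= s t -> Omega (x, t)) /\
     (forall n x t, Omega (x, t) -> ex_diff_n U n x t)) /\
  (forall x t, 0 < t -> 0 < x < s t -> U x t = T x t).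

(* One-phase solidification with a mushy zone and a convective condition at
   the fixed face. Only the values of [T x t] with t > 0 and 0 < x < s(t)
   are constrained; the values of T and T_x at x = 0 and x = s(t) are those
   of the smooth extension [U], and are uniquely determined by [T].
   The free boundaries are curves on [0, +oo[, continuous at the origin and
   differentiable for t > 0. *)
Record solves_P1 (k rho ell gamma Dinf h0 eps alpha : R)
    (T : R -> R -> R) (s r : R -> R) : Prop := {
  P1_s_pos : forall t, 0 < t -> 0 < s t;
  P1_s_lt_r : forall t, 0 < t -> s t < r t;
  P1_s_derivable : forall t, 0 < t -> ex_derive s t;
  P1_r_derivable : forall t, 0 < t -> ex_derive r t;
  P1_s_init : s 0 = 0 /\ filterlim s (at_right 0) (locally 0);
  P1_r_init : r 0 = 0 /\ filterlim r (at_right 0) (locally 0);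
  P1_heat : forall x t, 0 < t -> 0 < x < s t ->
    Derive (fun tau => T x tau) t
      - alpha * Derive_n (fun y => T y t) 2 x = 0;
  P1_boundary : exists U : R -> R -> R,
    smooth_extension s T U /\
    (forall t, 0 < t -> U (s t) t = 0) /\
    (forall t, 0 < t ->
       k * Derive (fun y => U y t) (s t)
       = rho * ell * (eps * Derive s t + (1 - eps) * Derive r t)) /\
    (forall t, 0 < t ->
       Derive (fun y => U y t) (s t) * (r t - s t) = gamma) /\
    (forall t, 0 < t ->
       k * Derive (fun y => U y t) 0 = h0 / sqrt t * (U 0 t + Dinf))
}.

(* Main.v *)
(* With [eta = x / (2 * sqrt (alpha * t))], every [b * (erf eta - erf xi)] solves
   the heat equation and vanishes on [x = 2 * xi * sqrt (alpha * t)]; its flux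
   there is a multiple of [1 / sqrt t], as are the speeds of the two fronts. The
   convective condition fixes [b], the condition on the width of the mushy zone
   fixes [mu - xi], and the Stefan condition becomes the equation for [xi].
   As [F] is positive and decreasing, [G - const * F] is strictly increasing and
   unbounded above, so a positive root exists when it is negative at 0, which is
   exactly [h0 > h0star].
   Smoothness of all orders for [t > 0] holds because the algebra generated by
   [/ (2 * sqrt (alpha * t))], [eta], [exp (- eta ^ 2)] and [erf eta] is stable
   under both partial derivatives. *)
Require Import Defs.
From Stdlib Require Import Reals Lra Ranalysis5.
From Coquelicot Require Import Coquelicot.
Open Scope R_scope.

(** * The error function: derivative, monotonicity and sign *)

Lemma is_derive_erf (x : R) :
  is_derive erf x (2 / sqrt PI * exp (- x ^ 2)).
Proof.
assert (Hc : forall u, continuous (fun u : R => exp (- u ^ 2)) u).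
{ intros u; apply (ex_derive_continuous (fun u : R => exp (- u ^ 2))).
  auto_derive; trivial. }
unfold erf.
apply (is_derive_scal (fun x => RInt (fun u => exp (- u ^ 2)) 0 x) x (2 / sqrt PI)).
apply (is_derive_RInt (fun u => exp (- u ^ 2)) _ 0); [|apply Hc].
apply filter_forall; intros b; apply (RInt_correct (V := R_CompleteNormedModule)).
apply (ex_RInt_continuous (V := R_CompleteNormedModule)).
intros z _; apply Hc.
Qed.

Lemma Derive_erf (x : R) : Derive erf x = 2 / sqrt PI * exp (- x ^ 2).
Proof. apply is_derive_unique, is_derive_erf. Qed.

Lemma ex_derive_erf (x : R) : ex_derive erf x.
Proof. eexists; apply is_derive_erf. Qed.

Lemma continuity_pt_erf (x : R) : continuity_pt erf x.
Proof.
apply continuity_pt_filterlim.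
apply (ex_derive_continuous erf), ex_derive_erf.
Qed.

Lemma erf_0 : erf 0 = 0.
Proof. unfold erf; rewrite RInt_point; unfold zero; simpl; ring. Qed.

Lemma erf_derive_pos (x : R) : 0 < 2 / sqrt PI * exp (- x ^ 2).
Proof.
apply Rmult_lt_0_compat; [|apply exp_pos].
apply Rdiv_lt_0_compat; [lra|apply sqrt_lt_R0, PI_RGT_0].
Qed.

Lemma erf_increasing (x y : R) : x < y -> erf x < erf y.
Proof.
intros Hxy.
apply (incr_function erf m_infty p_infty (fun x => 2 / sqrt PI * exp (- x ^ 2)));
  simpl; trivial; intros z _ _.
- apply is_derive_erf.
- apply erf_derive_pos.
Qed.

Lemma erf_pos (x : R) : 0 < x -> 0 < erf x.
Proof. intros Hx; generalize (erf_increasing 0 x Hx); now rewrite erf_0. Qed.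

(** * The transcendental equation for the similarity coefficient *)

Definition erf_ratio (m x : R) : R := exp (- x ^ 2) / (m + erf x).

Section TranscendentalEquation.

Variables m p q : R.
Hypotheses (hm : 0 < m) (hp : 0 < p) (hq : 0 < q).

Local Notation F := (erf_ratio m).

Lemma denominator_pos (x : R) : 0 <= x -> 0 < m + erf x.
Proof.
intros [Hx| <-].
- generalize (erf_pos x Hx); lra.
- rewrite erf_0; lra.
Qed.

Lemma erf_ratio_pos (x : R) : 0 <= x -> 0 < F x.
Proof.
intros Hx; apply Rdiv_lt_0_compat; [apply exp_pos|now apply denominator_pos].
Qed.

Lemma erf_ratio_decreasing (x y : R) : 0 <= x -> x < y -> F y < F x.
Proof.
intros Hx Hxy; unfold erf_ratio, Rdiv.
assert (Hd := denominator_pos x Hx).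
assert (He := erf_increasing x y Hxy).
apply Rmult_gt_0_lt_compat.
- apply Rinv_0_lt_compat, denominator_pos; lra.
- apply exp_pos.
- apply exp_increasing, Ropp_lt_contravar; simpl; nra.
- apply Rinv_lt_contravar; [apply Rmult_lt_0_compat|]; lra.
Qed.

Lemma gap_increasing (x y : R) : 0 <= x -> x < y ->
  x + q * (1 / F x) - p * F x < y + q * (1 / F y) - p * F y.
Proof.
intros Hx Hxy.
assert (HF := erf_ratio_decreasing x y Hx Hxy).
assert (Hy : 0 < F y) by (apply erf_ratio_pos; lra).
assert (Hi : 1 / F x < 1 / F y).
{ unfold Rdiv; rewrite !Rmult_1_l.
  apply Rinv_lt_contravar; [apply Rmult_lt_0_compat|]; lra. }
apply (Rmult_lt_compat_l q) in Hi; [|exact hq].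
apply (Rmult_lt_compat_l p) in HF; [|exact hp].
lra.
Qed.

Lemma continuity_pt_gap (x : R) : 0 <= x ->
  continuity_pt (fun x => x + q * (1 / F x) - p * F x) x.
Proof.
intros Hx; apply continuity_pt_filterlim.
apply (ex_derive_continuous (fun x => x + q * (1 / F x) - p * F x)).
assert (Hd := denominator_pos x Hx).
assert (HF := erf_ratio_pos x Hx); unfold erf_ratio in *.
auto_derive.
simpl in HF; repeat split; try apply ex_derive_erf; apply Rgt_not_eq; assumption.
Qed.

(** Since [F 0 = / m], the hypothesis says that the gap [G - p * F] is negative at 0. The
    intermediate value theorem then gives a root, and [gap_increasing] makes it unique. In the
    application [m], [p], [q] are the constants in the denominator of [F], in front of [F] and in
    front of [1 / F]. *)
Lemma erf_ratio_equation_unique_root : q * m < p / m ->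
  exists xi, unique (fun x => 0 < x /\ p * F x = x + q * (1 / F x)) xi.
Proof.
intros Hpq.
set (H := fun x => x + q * (1 / F x) - p * F x).
assert (HF0 : F 0 = / m).
{ unfold erf_ratio; rewrite erf_0, Rplus_0_r.
  replace (- 0 ^ 2) with 0 by ring; rewrite exp_0; field; lra. }
assert (H0 : H 0 < 0).
{ unfold H; rewrite HF0.
  replace (1 / / m) with m by (field; lra).
  change (p * / m) with (p / m); lra. }
(* At this point the linear term alone beats [p * F M], because [F M < F 0]. *)
set (M := p * F 0).
assert (HM : 0 < M) by (apply Rmult_lt_0_compat; [lra|apply erf_ratio_pos; lra]).
assert (HHM : 0 < H M).
{ unfold H.
  assert (HF := erf_ratio_decreasing 0 M (Rle_refl 0) HM).
  apply (Rmult_lt_compat_l p) in HF; [|exact hp].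
  assert (0 < q * (1 / F M)).
  { apply Rmult_lt_0_compat; [lra|].
    apply Rdiv_lt_0_compat; [lra|apply erf_ratio_pos; lra]. }
  fold M in HF; lra. }
destruct (IVT_interv H 0 M) as [xi [[Hxi0 HxiM] Hxi]]; trivial.
{ intros a [Ha _]; now apply continuity_pt_gap. }
assert (Hpos : 0 < xi).
{ destruct Hxi0 as [Hlt|Heq]; [exact Hlt|].
  rewrite <- Heq in Hxi; lra. }
exists xi; split.
- split; [exact Hpos|]; unfold H in Hxi; lra.
- intros y [Hy Hey].
  destruct (Rtotal_order xi y) as [Hlt|[Heq|Hgt]]; [|exact Heq|].
  + assert (Hi := gap_increasing xi y Hxi0 Hlt); unfold H in Hxi; lra.
  + assert (Hi := gap_increasing y xi (Rlt_le _ _ Hy) Hgt); unfold H in Hxi; lra.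
Qed.

End TranscendentalEquation.

(** * Smoothness of functions of the similarity variable *)

Section SimilarityVariable.

Variable alpha : R.
Hypothesis halpha : 0 < alpha.

(** Given as an inductive predicate so that closure under differentiation is an induction on
    generators, sums and products, and membership of a concrete formula follows from its syntax. *)
Inductive similarity_algebra : (R -> R -> R) -> Prop :=
| sim_const a : similarity_algebra (fun _ _ => a)
| sim_scale : similarity_algebra (fun _ t => / (2 * sqrt (alpha * t)))
| sim_eta : similarity_algebra (fun x t => x / (2 * sqrt (alpha * t)))
| sim_gauss : similarity_algebra (fun x t => exp (- (x / (2 * sqrt (alpha * t))) ^ 2))
| sim_erf : similarity_algebra (fun x t => erf (x / (2 * sqrt (alpha * t))))
| sim_plus f g : similarity_algebra f -> similarity_algebra g ->
    similarity_algebra (fun x t => f x t + g x t)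
| sim_mult f g : similarity_algebra f -> similarity_algebra g ->
    similarity_algebra (fun x t => f x t * g x t).

Lemma continuity_2d_pt_scale (x t : R) : 0 < t ->
  continuity_2d_pt (fun _ t => / (2 * sqrt (alpha * t))) x t.
Proof.
intros Ht.
assert (Hs : 0 < sqrt (alpha * t)) by (apply sqrt_lt_R0, Rmult_lt_0_compat; lra).
apply (continuity_1d_2d_pt_comp (fun t => / (2 * sqrt (alpha * t))) (fun _ t => t));
  [|apply continuity_2d_pt_id2].
apply continuity_pt_filterlim.
apply (ex_derive_continuous (fun t => / (2 * sqrt (alpha * t)))).
auto_derive; repeat split; nra.
Qed.

Lemma continuity_2d_pt_eta (x t : R) : 0 < t ->
  continuity_2d_pt (fun x t => x / (2 * sqrt (alpha * t))) x t.
Proof.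
intros Ht; apply continuity_2d_pt_mult.
- apply continuity_2d_pt_id1.
- now apply continuity_2d_pt_scale.
Qed.

Lemma similarity_algebra_continuity (f : R -> R -> R) (x t : R) :
  similarity_algebra f -> 0 < t -> continuity_2d_pt f x t.
Proof.
intros Hf Ht; induction Hf.
- apply continuity_2d_pt_const.
- now apply continuity_2d_pt_scale.
- now apply continuity_2d_pt_eta.
- apply (continuity_1d_2d_pt_comp (fun u => exp (- u ^ 2))); [|now apply continuity_2d_pt_eta].
  apply continuity_pt_filterlim.
  apply (ex_derive_continuous (fun u => exp (- u ^ 2))); auto_derive; trivial.
- apply continuity_1d_2d_pt_comp; [apply continuity_pt_erf|now apply continuity_2d_pt_eta].
- now apply continuity_2d_pt_plus.
- now apply continuity_2d_pt_mult.
Qed.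

Lemma is_derive_eta_x (x t : R) :
  is_derive (fun x => x / (2 * sqrt (alpha * t))) x (/ (2 * sqrt (alpha * t))).
Proof. auto_derive; [trivial|ring]. Qed.

(* [1 / t] is expressed through the scale [w = / (2 * sqrt (alpha * t))],
   as [1 / t = 4 * alpha * w ^ 2]. *)
Lemma is_derive_eta_t (x t : R) : 0 < t ->
  let w := / (2 * sqrt (alpha * t)) in
  is_derive (fun t => x / (2 * sqrt (alpha * t))) t (-2 * alpha * (x * w) * (w * w)).
Proof.
intros Ht w.
assert (Hat : 0 < alpha * t) by (apply Rmult_lt_0_compat; lra).
assert (Hs : 0 < sqrt (alpha * t)) by now apply sqrt_lt_R0.
unfold w; auto_derive; [repeat split; nra|].
assert (sqrt (alpha * t) * sqrt (alpha * t) = alpha * t) by (apply sqrt_sqrt; lra).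
field; lra.
Qed.

(** With [w] the scale, [eta_x = w], [eta_t = -2 * alpha * eta * w ^ 2] and
    [w_t = -2 * alpha * w ^ 3] stay in the algebra; the chain rule handles the Gaussian and [erf],
    the Leibniz rule the products. *)
Lemma similarity_algebra_derive (f : R -> R -> R) : similarity_algebra f ->
  exists fx ft, similarity_algebra fx /\ similarity_algebra ft /\
    forall x t, 0 < t ->
      is_derive (fun x => f x t) x (fx x t) /\ is_derive (fun t => f x t) t (ft x t).
Proof.
intros Hf; induction Hf as
  [a| | | | |f g Hf [fx [ft [Hfx [Hft Df]]]] Hg [gx [gt [Hgx [Hgt Dg]]]]
   |f g Hf [fx [ft [Hfx [Hft Df]]]] Hg [gx [gt [Hgx [Hgt Dg]]]]].
- exists (fun _ _ => 0), (fun _ _ => 0).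
  split; [constructor|split; [constructor|]].
  intros x t _; split; apply (is_derive_const (V := R_NormedModule)).
- set (w := fun _ t : R => / (2 * sqrt (alpha * t))).
  exists (fun _ _ => 0), (fun x t => -2 * alpha * (w x t * (w x t * w x t))).
  split; [constructor|split].
  + repeat constructor.
  + intros x t Ht; split; [apply (is_derive_const (V := R_NormedModule))|].
    (* The scale is [eta] at [x = 1], so its time derivative is a case of [is_derive_eta_t]. *)
    apply (is_derive_ext (fun t => 1 / (2 * sqrt (alpha * t)))).
    { intros u; unfold w; apply Rmult_1_l. }
    replace (-2 * alpha * _) with (-2 * alpha * (1 * w x t) * (w x t * w x t)) by ring.
    now apply is_derive_eta_t.
- set (w := fun _ t : R => / (2 * sqrt (alpha * t))).
  exists w, (fun x t => -2 * alpha * (x / (2 * sqrt (alpha * t))) * (w x t * w x t)).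
  split; [constructor|split].
  + repeat constructor.
  + intros x t Ht; split; [apply is_derive_eta_x|now apply is_derive_eta_t].
- set (w := fun _ t : R => / (2 * sqrt (alpha * t))).
  set (eta := fun x t : R => x / (2 * sqrt (alpha * t))).
  exists (fun x t => w x t * (-2 * eta x t * exp (- (eta x t) ^ 2))),
    (fun x t => (-2 * alpha * eta x t * (w x t * w x t))
                * (-2 * eta x t * exp (- (eta x t) ^ 2))).
  assert (D : forall u, is_derive (fun u => exp (- u ^ 2)) u (-2 * u * exp (- u ^ 2))).
  { intros u; auto_derive; [trivial|simpl; ring]. }
  split; [|split].
  + repeat constructor.
  + repeat constructor.
  + intros x t Ht; split.
    * apply (is_derive_comp (fun u => exp (- u ^ 2))); [apply D|apply is_derive_eta_x].
    * apply (is_derive_comp (fun u => exp (- u ^ 2))); [apply D|now apply is_derive_eta_t].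
- set (w := fun _ t : R => / (2 * sqrt (alpha * t))).
  set (eta := fun x t : R => x / (2 * sqrt (alpha * t))).
  exists (fun x t => w x t * (2 / sqrt PI * exp (- (eta x t) ^ 2))),
    (fun x t => (-2 * alpha * eta x t * (w x t * w x t))
                * (2 / sqrt PI * exp (- (eta x t) ^ 2))).
  split; [|split].
  + repeat constructor.
  + repeat constructor.
  + intros x t Ht; split.
    * apply (is_derive_comp erf); [apply is_derive_erf|apply is_derive_eta_x].
    * apply (is_derive_comp erf); [apply is_derive_erf|now apply is_derive_eta_t].
- exists (fun x t => fx x t + gx x t), (fun x t => ft x t + gt x t).
  split; [now constructor|split; [now constructor|]].
  intros x t Ht; destruct (Df x t Ht), (Dg x t Ht).
  split; now apply (is_derive_plus (V := R_NormedModule)).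
- exists (fun x t => fx x t * g x t + f x t * gx x t),
    (fun x t => ft x t * g x t + f x t * gt x t).
  split; [repeat constructor; assumption|split; [repeat constructor; assumption|]].
  intros x t Ht; destruct (Df x t Ht), (Dg x t Ht).
  split.
  + apply (is_derive_mult (fun x => f x t) (fun x => g x t)); trivial; apply Rmult_comm.
  + apply (is_derive_mult (f x) (g x)); trivial; apply Rmult_comm.
Qed.

Lemma open_upper_half_plane : open (fun xt : R * R => 0 < snd xt).
Proof.
apply (open_comp snd (fun t => 0 < t)); [|apply open_gt].
intros [x t] _; apply (@continuous_snd R_UniformSpace R_UniformSpace x t).
Qed.

(** Induction on the order: both partial derivatives are again in the algebra, so the induction
    hypothesis applies to them. *)
Lemma similarity_algebra_smooth (f : R -> R -> R) (n : nat) (x t : R) :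
  similarity_algebra f -> 0 < t -> ex_diff_n f n x t.
Proof.
revert f x t; induction n as [|n IH]; intros f x t Hf Ht.
- split; [now apply similarity_algebra_continuity|trivial].
- destruct (similarity_algebra_derive f Hf) as [fx [ft [Hfx [Hft D]]]].
  (* [Derive] is known to agree with [fx] and [ft] only for positive time; the half-plane being
     open, this is agreement near the point. *)
  assert (Hloc : forall P : R -> R -> Prop,
    (forall x t, 0 < t -> P x t) -> locally_2d P x t).
  { intros P HP; apply locally_2d_locally.
    apply (locally_open _ _ open_upper_half_plane (fun xt => HP (fst xt) (snd xt)) (x, t) Ht). }
  split; [now apply similarity_algebra_continuity|repeat split].
  + exists (fx x t); now apply D.
  + exists (ft x t); now apply D.
  + apply ex_diff_n_ext_loc with fx; [|now apply IH].
    apply Hloc; intros u v Hv; symmetry; apply is_derive_unique; now apply D.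
  + apply ex_diff_n_ext_loc with ft; [|now apply IH].
    apply Hloc; intros u v Hv; symmetry; apply is_derive_unique; now apply D.
Qed.

End SimilarityVariable.

(** * The similarity profile as a solution of the heat equation *)

Definition similarity_profile (alpha b e0 x t : R) : R :=
  b * (erf (x / (2 * sqrt (alpha * t))) - e0).

Section SimilarityProfile.

Variables alpha b e0 : R.
Hypothesis halpha : 0 < alpha.

Local Notation U := (similarity_profile alpha b e0).

Lemma profile_smooth (n : nat) (x t : R) : 0 < t -> ex_diff_n U n x t.
Proof.
intros Ht; apply (similarity_algebra_smooth alpha halpha); [|exact Ht].
unfold similarity_profile, Rminus; repeat constructor.
Qed.

Lemma Derive_profile_x (x t : R) : 0 < t ->
  Derive (fun x => U x t) x
  = b * exp (- (x / (2 * sqrt (alpha * t))) ^ 2) / (sqrt PI * sqrt (alpha * t)).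
Proof.
intros Ht; apply is_derive_unique; unfold similarity_profile.
assert (Hs : 0 < sqrt (alpha * t)) by (apply sqrt_lt_R0, Rmult_lt_0_compat; lra).
assert (HP : 0 < sqrt PI) by apply sqrt_lt_R0, PI_RGT_0.
auto_derive; [apply ex_derive_erf|].
rewrite Derive_erf; fold (x / (2 * sqrt (alpha * t))).
set (E := exp _); field; lra.
Qed.

Lemma profile_heat (x t : R) : 0 < t ->
  Derive (fun tau => U x tau) t = alpha * Derive_n (fun y => U y t) 2 x.
Proof.
intros Ht.
assert (Hat : 0 < alpha * t) by (apply Rmult_lt_0_compat; lra).
assert (Hs : 0 < sqrt (alpha * t)) by now apply sqrt_lt_R0.
assert (HP : 0 < sqrt PI) by apply sqrt_lt_R0, PI_RGT_0.
assert (Hss : sqrt (alpha * t) * sqrt (alpha * t) = alpha * t) by (apply sqrt_sqrt; lra).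
change (Derive_n (fun y => U y t) 2 x)
  with (Derive (fun y => Derive (fun z => U z t) y) x).
rewrite (Derive_ext (fun y => Derive (fun z => U z t) y) _ x (fun y => Derive_profile_x y t Ht)).
set (E := exp (- (x / (2 * sqrt (alpha * t))) ^ 2)).
(* This is [U_xx], from differentiating the Gaussian gradient; the first goal compares [U_t] with
   [alpha] times it, the second verifies it. *)
replace (Derive _ x)
  with (- b * E * x / (2 * sqrt PI * sqrt (alpha * t) ^ 3)).
- apply is_derive_unique; unfold similarity_profile.
  auto_derive; [repeat split; try apply ex_derive_erf; nra|].
  rewrite Derive_erf; fold (x / (2 * sqrt (alpha * t))); fold E.
  field; lra.
- symmetry; apply is_derive_unique.
  auto_derive; [trivial|].
  simpl; change (exp _) with E; field; lra.
Qed.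

End SimilarityProfile.

(** * Free boundaries growing like the square root of time *)

Lemma is_derive_sqrt_growth (alpha a t : R) : 0 < alpha -> 0 < t ->
  is_derive (fun t => 2 * a * sqrt (alpha * t)) t (a * sqrt alpha / sqrt t).
Proof.
intros Ha Ht.
assert (0 < sqrt alpha) by now apply sqrt_lt_R0.
assert (0 < sqrt t) by now apply sqrt_lt_R0.
assert (sqrt alpha * sqrt alpha = alpha) by (apply sqrt_sqrt; lra).
auto_derive; [nra|].
rewrite sqrt_mult by lra.
replace (alpha * 1) with (sqrt alpha * sqrt alpha) by lra.
field; lra.
Qed.

Lemma sqrt_growth_init (alpha a : R) :
  2 * a * sqrt (alpha * 0) = 0 /\
  filterlim (fun t => 2 * a * sqrt (alpha * t)) (at_right 0) (locally 0).
Proof.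
assert (H0 : 2 * a * sqrt (alpha * 0) = 0) by (rewrite Rmult_0_r, sqrt_0; ring).
split; [exact H0|].
(* The two-sided limit is available, since [sqrt] is 0 on negative numbers and hence continuous at
   0. *)
apply (filterlim_filter_le_1 _ (filter_le_within _)).
rewrite <- H0 at 2.
apply (continuous_scal_r (K := R_AbsRing) (V := R_NormedModule) (2 * a) (fun t => sqrt (alpha * t)) 0).
apply (continuous_comp (fun t => alpha * t) sqrt); [|apply continuous_sqrt].
apply (ex_derive_continuous (fun t => alpha * t)); auto_derive; trivial.
Qed.

(** * Verification of the explicit solution *)

Theorem theorem1 (k rho c ell gamma Dinf h0 eps : R)
    (hk : 0 < k) (hrho : 0 < rho) (hc : 0 < c) (hell : 0 < ell)
    (hgamma : 0 < gamma) (hDinf : 0 < Dinf) (hh0 : 0 < h0)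
    (heps : 0 < eps < 1) :
  let alpha := k / (rho * c) in
  let h0star := 1 / Dinf * sqrt (gamma * (1 - eps) * rho * ell * k / 2) in
  let F := fun x : R => exp (- x ^ 2) / (k / (h0 * sqrt (PI * alpha)) + erf x) in
  let G := fun x : R =>
    x + gamma * (1 - eps) * sqrt PI / (2 * Dinf) * (1 / F x) in
  h0 > h0star ->
  exists xi : R,
    unique (fun x : R => 0 < x /\ Dinf * c / (ell * sqrt PI) * F x = G x) xi /\
    let mu :=
      xi + gamma * k / (2 * Dinf * h0 * sqrt alpha) * exp (xi ^ 2)
           * (1 + h0 * sqrt (PI * alpha) / k * erf xi) in
    let T := fun x t : R =>
      - (h0 * Dinf * sqrt (PI * alpha) / k * erf xi
         / (1 + h0 * sqrt (PI * alpha) / k * erf xi))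
      * (1 - erf (x / (2 * sqrt (alpha * t))) / erf xi) in
    let s := fun t : R => 2 * xi * sqrt (alpha * t) in
    let r := fun t : R => 2 * mu * sqrt (alpha * t) in
    solves_P1 k rho ell gamma Dinf h0 eps alpha T s r.
Proof.
intros alpha h0star F G Hh.
assert (halpha : 0 < alpha).
{ apply Rdiv_lt_0_compat; [lra|now apply Rmult_lt_0_compat]. }
assert (Hsa : 0 < sqrt alpha) by now apply sqrt_lt_R0.
assert (Hpi : 0 < sqrt PI) by apply sqrt_lt_R0, PI_RGT_0.
assert (Haa : sqrt alpha * sqrt alpha = alpha) by (apply sqrt_sqrt; lra).
assert (Hpa : sqrt (PI * alpha) = sqrt PI * sqrt alpha).
{ apply sqrt_mult; [left; apply PI_RGT_0|lra]. }
(* Eliminating [c] leaves [sqrt alpha] as an independent atom, so that [field] can close the later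
   identities. *)
assert (Hcalpha : c = k / (rho * (sqrt alpha * sqrt alpha))).
{ rewrite Haa; unfold alpha; field; lra. }
assert (Hm : 0 < k / (h0 * sqrt (PI * alpha))).
{ rewrite Hpa; apply Rdiv_lt_0_compat; [lra|].
  repeat apply Rmult_lt_0_compat; lra. }
assert (Hp : 0 < Dinf * c / (ell * sqrt PI)).
{ apply Rdiv_lt_0_compat; now apply Rmult_lt_0_compat. }
assert (Hq : 0 < gamma * (1 - eps) * sqrt PI / (2 * Dinf)).
{ apply Rdiv_lt_0_compat; [|lra]; repeat apply Rmult_lt_0_compat; lra. }
destruct (erf_ratio_equation_unique_root _ _ _ Hm Hp Hq) as [xi Hxi].
(* Negativity of the gap at 0: squaring [h0 > h0star] gives [X < (Dinf * h0) ^ 2], and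
   [p / m - q * m] is a positive multiple of the difference. *)
{ set (X := gamma * (1 - eps) * rho * ell * k / 2) in h0star.
  assert (HX : 0 < X).
  { unfold X; apply Rdiv_lt_0_compat; [|lra].
    repeat apply Rmult_lt_0_compat; lra. }
  assert (Hlt : sqrt X < Dinf * h0).
  { apply (Rmult_lt_compat_l Dinf) in Hh; [|lra].
    unfold h0star in Hh; replace (Dinf * (1 / Dinf * sqrt X)) with (sqrt X) in Hh
      by (field; lra); lra. }
  assert (HXlt : X < (Dinf * h0) * (Dinf * h0)).
  { rewrite <- (sqrt_sqrt X) by lra.
    assert (0 <= sqrt X) by apply sqrt_pos.
  nra. }
  rewrite Hpa.
  apply Rlt_0_minus.
  replace (_ - _) with
    (((Dinf * h0) * (Dinf * h0) - X) / (Dinf * h0 * rho * ell * sqrt alpha)).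
  - apply Rdiv_lt_0_compat; [lra|]; repeat apply Rmult_lt_0_compat; lra.
  - unfold X; rewrite Hcalpha; field; lra. }
exists xi; split; [exact Hxi|].
destruct Hxi as [[Hxi Heq] _].
change (Dinf * c / (ell * sqrt PI) * F xi = G xi) in Heq.
intros mu T s r.
assert (He : 0 < erf xi) by now apply erf_pos.
(* [A] is the inverse of the constant in the denominator of [F]; with [d] below, that denominator at
   [xi] is [d / A]. *)
set (A := h0 * sqrt (PI * alpha) / k) in *.
assert (HA : 0 < A).
{ unfold A; rewrite Hpa; apply Rdiv_lt_0_compat; [|lra].
  repeat apply Rmult_lt_0_compat; lra. }
set (d := 1 + A * erf xi) in *.
assert (Hd : 0 < d).
{ assert (0 < A * erf xi) by now apply Rmult_lt_0_compat.
  unfold d; lra. }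
assert (HE := exp_pos (xi ^ 2)).
(* The convective condition reads [b = A * (Dinf - b * erf xi)] for the amplitude [b], whence
   [b = Dinf * A / d]. *)
set (U := similarity_profile alpha (Dinf * A / d) (erf xi)).
assert (Hmu : mu - xi = gamma * k / (2 * Dinf * h0 * sqrt alpha) * exp (xi ^ 2) * d).
{ unfold mu; ring. }
assert (Hgap : 0 < mu - xi).
{ assert (0 < gamma * k / (2 * Dinf * h0 * sqrt alpha)).
  { apply Rdiv_lt_0_compat; repeat apply Rmult_lt_0_compat; lra. }
  rewrite Hmu; apply Rmult_lt_0_compat; [now apply Rmult_lt_0_compat|lra]. }
assert (HTU : forall x t, T x t = U x t).
{ intros x t; unfold T, U, similarity_profile.
  replace (h0 * Dinf * sqrt (PI * alpha) / k) with (Dinf * A) by (unfold A; field; lra).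
  field; lra. }
assert (Hs : forall t, 0 < t -> 0 < sqrt (alpha * t)).
{ intros t Ht; apply sqrt_lt_R0, Rmult_lt_0_compat; lra. }
assert (Hst : forall t, 0 < t -> 0 < sqrt t) by (intros t; apply sqrt_lt_R0).
assert (Heta : forall t, 0 < t -> s t / (2 * sqrt (alpha * t)) = xi).
{ intros t Ht; specialize (Hs t Ht); unfold s; field; lra. }
assert (Hflux : forall t, 0 < t ->
  Derive (fun y => U y t) (s t) = Dinf * h0 / (k * d * exp (xi ^ 2) * sqrt t)).
{ intros t Ht; specialize (Hst t Ht); unfold U.
  rewrite Derive_profile_x by trivial; rewrite Heta by trivial.
  rewrite sqrt_mult by lra.
  unfold A; rewrite Hpa, exp_Ropp; field; lra. }
assert (HFxi : F xi = A / (exp (xi ^ 2) * d)).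
{ assert (0 < k + h0 * sqrt PI * sqrt alpha * erf xi).
  { apply Rplus_lt_0_compat; [lra|].
    repeat (apply Rmult_lt_0_compat; [|assumption]); lra. }
  unfold F, d, A; rewrite Hpa, exp_Ropp; field; lra. }
constructor.
- intros t Ht; specialize (Hs t Ht); unfold s; apply Rmult_lt_0_compat; lra.
- intros t Ht; specialize (Hs t Ht); unfold s, r; apply Rmult_lt_compat_r; lra.
- intros t Ht; eexists; now apply is_derive_sqrt_growth.
- intros t Ht; eexists; now apply is_derive_sqrt_growth.
- apply sqrt_growth_init.
- apply sqrt_growth_init.
- intros x t Ht _.
  rewrite (Derive_ext _ (fun tau => U x tau)) by (intros; apply HTU).
  rewrite (Derive_n_ext _ (fun y => U y t)) by (intros; apply HTU).
  unfold U; rewrite profile_heat by trivial; ring.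
- exists U; split; [split|split; [|split; [|split]]].
  (* The formula is smooth on the whole half-plane of positive times, so one [Omega] serves both
     edges. *)
  + exists (fun xt => 0 < snd xt); split; [apply open_upper_half_plane|split].
    * intros x t Ht _; exact Ht.
    * intros n x t Ht; now apply profile_smooth.
  + intros x t _ _; symmetry; apply HTU.
  + intros t Ht; unfold U, similarity_profile; rewrite Heta by trivial; ring.
  + intros t Ht; rewrite Hflux by trivial.
    replace (Derive s t) with (xi * sqrt alpha / sqrt t)
      by (symmetry; apply is_derive_unique; now apply is_derive_sqrt_growth).
    replace (Derive r t) with (mu * sqrt alpha / sqrt t)
      by (symmetry; apply is_derive_unique; now apply is_derive_sqrt_growth).
    specialize (Hst t Ht).
    replace mu with (xi + (mu - xi)) by ring; rewrite Hmu.
    (* The weighted front speed is proportional to [xi + (1 - eps) * (mu - xi)], which is [G xi];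
       the flux gives the other side of the equation, with the same factor. *)
    transitivity (rho * ell * (sqrt alpha / sqrt t)
                  * (Dinf * c / (ell * sqrt PI) * F xi)).
    * rewrite HFxi, Hcalpha; unfold A; rewrite Hpa; field; lra.
    * rewrite Heq; unfold G; rewrite HFxi; unfold A; rewrite Hpa; field; lra.
  + intros t Ht; rewrite Hflux by trivial.
    replace (r t - s t) with (2 * (mu - xi) * sqrt (alpha * t)) by (unfold r, s; ring).
    specialize (Hst t Ht).
    rewrite Hmu, sqrt_mult by lra.
    field; lra.
  + intros t Ht; specialize (Hst t Ht); specialize (Hs t Ht).
    unfold U; rewrite Derive_profile_x by trivial.
    unfold similarity_profile.
    replace (0 / (2 * sqrt (alpha * t))) with 0 by (field; lra).
    rewrite erf_0.
    replace (- 0 ^ 2) with 0 by ring; rewrite exp_0.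
    (* At the fixed face [1 - A * erf xi / d = 1 / d], by the choice of [d]. *)
    replace (Dinf * A / d * (0 - erf xi) + Dinf) with (Dinf / d) by (unfold d; field; fold d; lra).
    unfold A; rewrite Hpa, sqrt_mult by lra.
    field; lra.
Qed.
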